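(* Let $L$ be a finite ranked lattice with rank function $\rho$ and Möbius function $\mu$, and let $(A_1,\dots,A_n)$ be an ordered partition of the atom set of $L$. Suppose that (1) for all $x\in L$, $\mathcal{T}_x^A\neq\emptyset$; (2) for all $x\in L$ and all $\mathbf{t}\in\mathcal{T}_x^A$, $|\operatorname{supp}\mathbf{t}|=\rho(x)$; (3) for each $x\in L$ with $x\neq\hat{0}$ there is some $i$ with $|A_i\cap A_x|=1$. Then (a) for all $x\in L$, $\mu(x)=(-1)^{\rho(x)}|\mathcal{T}_x^A|$; and (b) $\chi(L,t)=\prod_{i=1}^n(t-|A_i|)$.
   Context: An atomic transversal is a tuple $\mathbf{t}=(t_1,\dots,t_n)$ with $t_i\in A_i\cup\{\hat{0}\}$ for each $i$ (equivalently an element of the product of claws $\prod_i CL_{A_i}$, where $CL_A$ is the poset consisting of $\hat{0}$ and the elements of $A$ as atoms). $\operatorname{supp}\mathbf{t}$ is the set of indices $i$ with $t_i\neq\hat{0}$ and $\bigvee\mathbf{t}=t_1\vee\cdots\vee t_n$ in $L$. For $x\in L$, $\mathcal{T}_x^A$ is the set of atomic transversals $\mathbf{t}$ with $\bigvee\mathbf{t}=x$. $A_x$ denotes the set of atoms of $L$ below $x$. The characteristic polynomial is $\chi(L,t)=\sum_{x\in L}\mu(x)t^{\rho(L)-\rho(x)}$, where $\rho(L)$ is the maximum rank and $\mu$ is defined by $\sum_{y\leq x}\mu(y)=\delta_{\hat{0},x}$. *)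

(* Defs.v *)
From HB Require Import structures.
From mathcomp Require Import all_boot all_order all_algebra.

Set Implicit Arguments.
Unset Strict Implicit.
Unset Printing Implicit Defensive.

Import Order.Theory GRing.Theory.
Local Open Scope order_scope.

Section Defs.
Context {d : Order.disp_t} {L : finTBLatticeType d}.
Implicit Types (x y a : L) (rho : L -> nat).

Definition cover_rel : rel L :=
  [rel x y | (x < y) && [forall z : L, ~~ (x < z < y)]].

Definition atoms : {set L} := [set a : L | cover_rel \bot a].

(* The set written A_x. *)
Definition atoms_below x : {set L} := [set a in atoms | a <= x].

(* L is ranked with rank function rho: for every x, all saturated chains from
   the bottom element to x have the same length, namely rho x. The chain
   \bot :: c has size c steps. Since L is finite such chains always exist, so
   rho is determined by L. *)
Definition is_rank_function rho : Prop :=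
  forall x (c : seq L),
    path cover_rel \bot c -> last \bot c = x -> size c = rho x.

Definition lattice_rank rho : nat := (\max_(x : L) rho x)%N.

(* The natural number is recursion fuel; sum_moebius below is the defining
   relation of the Möbius function. *)
Fixpoint moebius_rec (k : nat) x : int :=
  if k is k'.+1 then
    ((x == \bot)%:R - \sum_(y : L | (y < x)%O) moebius_rec k' y)%R
  else 0%R.

Definition moebius x : int := moebius_rec #|[set y : L | (y <= x)%O]| x.

Lemma moebius_recE k x :
  (#|[set y : L | (y <= x)%O]| <= k)%N -> moebius_rec k x = moebius x.
Proof.
rewrite /moebius; have [m] := ubnP #|[set y : L | (y <= x)%O]|.
elim: m x k => // m IH x k lem.
have: (0 < #|[set y : L | (y <= x)%O]|)%N.
  by apply/card_gt0P; exists x; rewrite inE.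
case cx: #|[set y : L | (y <= x)%O]| lem => [//|c] lem _.
case: k => // k lek /=; congr (_ - _)%R; apply: eq_bigr => y ltyx.
have lty : (#|[set z : L | (z <= y)%O]| <= c)%N.
  rewrite -ltnS -cx; apply: proper_card; apply/properP; split.
    by apply/subsetP => z; rewrite !inE => /le_trans -> //; apply: ltW.
  by exists x; rewrite !inE // lt_geF.
have ltym : (#|[set z : L | (z <= y)%O]| < m)%N by exact: leq_ltn_trans lty _.
by rewrite !IH // (leq_trans lty).
Qed.

Lemma sum_moebius x :
  (\sum_(y : L | (y <= x)%O) moebius y = (x == \bot)%:R :> int)%R.
Proof.
rewrite (bigD1 x) //=.
rewrite -(@moebius_recE #|[set y : L | (y <= x)%O]|.+1 x) //=.
rewrite -addrA -[RHS]addr0; congr (_ + _)%R; apply/eqP.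
rewrite addrC subr_eq0; apply/eqP; apply: eq_big => [y|y ltyx].
  by rewrite lt_def eq_sym andbC.
rewrite moebius_recE //; apply: subset_leq_card; apply/subsetP => z.
by rewrite !inE => /le_trans -> //; case/andP: ltyx.
Qed.

Definition char_polynomial rho : {poly int} :=
  (\sum_(x : L) moebius x *: 'X^(lattice_rank rho - rho x))%R.

Section Transversals.
Variables (n : nat) (A : 'I_n -> {set L}).

(* By the definition of partition, the blocks are nonempty. *)
Definition ordered_atom_partition : Prop :=
  injective A /\ partition [set A i | i : 'I_n] atoms.

Definition atomic_transversal (t : {ffun 'I_n -> L}) : bool :=
  [forall i, t i \in \bot |: A i].

Definition supp (t : {ffun 'I_n -> L}) : {set 'I_n} := [set i | t i != \bot].

(* The set written T_x^A. *)
Definition transversals x : {set {ffun 'I_n -> L}} :=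
  [set t | atomic_transversal t & \join_(i < n) t i == x].

End Transversals.
End Defs.

(* Main.v *)
Require Import Defs.
From mathcomp Require Import all_boot all_order all_algebra.

Import Order.Theory GRing.Theory.
Local Open Scope ring_scope.

(** Expanding [\prod_i (c - #|B i|)] by choosing in each factor either [c] or
    one of the elements of [B i] gives a signed sum over transversals.  With
    [c = 1] and [B i] the elements of [A i] below [x], hypotheses (2) and (3)
    show that [(-1) ^ rho x * #|T_x|] satisfies the recurrence defining [mu];
    with [c = 'X] and [B = A] the same expansion is the characteristic
    polynomial, the lattice having rank [n] because the blocks are nonempty. *)

Section TransversalExpansion.
Context {d : Order.disp_t} {L : finTBLatticeType d}.
Variable n : nat.
Implicit Types (A B : 'I_n -> {set L}) (t : {ffun 'I_n -> L}) (x : L).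

Lemma transversal_expansion (R : comNzRingType) (c : R) B :
    (forall i, \bot%O \notin B i) ->
  \prod_(i < n) (c - #|B i|%:R) =
  \sum_(t | atomic_transversal B t) (-1) ^+ #|supp t| * c ^+ (n - #|supp t|).
Proof.
move=> B0.
(* As [\bot] lies outside [B i], it can mark the choice of [c]; a choice function for the expanded
   product is then exactly an atomic transversal. *)
have factorE i : c - #|B i|%:R =
    \sum_(a in \bot%O |: B i) (if a == \bot%O then c else -1).
  rewrite big_setU1 //= eqxx; congr (_ + _).
  rewrite (eq_bigr (fun=> -1)) ?sumr_const ?mulNrn // => a aB.
  by case: eqP aB => // ->; rewrite (negPf (B0 i)).
rewrite (eq_bigr _ (fun i _ => factorE i)).
rewrite bigA_distr_big_dep.
apply: eq_big => [t //|t _].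
rewrite (bigID [pred i | i \in supp t]) /=; congr (_ * _).
  rewrite (eq_bigr (fun=> -1)) ?prodr_const // => i.
  by rewrite inE => /negPf ->.
rewrite (eq_bigr (fun=> c)); last by move=> i; rewrite inE negbK => ->.
rewrite prodr_const -[X in (X - _)%N]card_ord -(cardC (mem (supp t))).
by rewrite addKn.
Qed.

Lemma notin_bot_partition A i : ordered_atom_partition A -> \bot%O \notin A i.
Proof.
case=> _ /and3P[/eqP covA _ _]; apply/negP => botA.
have : \bot%O \in atoms (L := L).
  by rewrite -covA; apply/bigcupP; exists (A i) => //; apply: imset_f.
by rewrite inE /cover_rel /= ltxx.
Qed.

Lemma block_nonempty A i : ordered_atom_partition A -> A i != set0.
Proof.
case=> _ /and3P[_ _]; apply: contraNneq => <-; exact: imset_f.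
Qed.

Lemma block_sub_atoms A i : ordered_atom_partition A -> A i \subset atoms.
Proof.
by case=> _ /and3P[/eqP <- _ _]; apply: bigcup_sup; apply: imset_f.
Qed.

(** A join is below [x] exactly when all its entries are, and [\bot] always is. Hence truncating the
    blocks at [x] turns the product over blocks into a sum over the [y] below [x]. *)
Lemma atomic_transversal_below A x t : ordered_atom_partition A ->
  atomic_transversal (fun i => A i :&: atoms_below x) t =
  atomic_transversal A t && (\join_(i < n) t i <= x)%O.
Proof.
move=> hA; apply/forallP/andP => [tAx|[/forallP tA /joinsP tx] i].
  split; first by apply/forallP => i; have := tAx i; rewrite !inE;
    case: eqP => //= _ /and3P[].
  apply/joinsP => i _; have := tAx i; rewrite !inE.
  by case/predU1P => [->|/and3P[]] //; apply: le0x.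
have := tA i; rewrite !in_setU1; case: eqP => //= _ tiA.
by rewrite inE tiA inE (subsetP (block_sub_atoms _ i hA)) // tx.
Qed.

(** The recurrence is triangular: by strong induction on the size of the lower set of [x], the terms
    strictly below [x] agree and cancel. *)
Lemma moebius_unique (f : L -> int) :
    (forall x, \sum_(y | (y <= x)%O) f y = (x == \bot%O)%:R) ->
  forall x, moebius x = f x.
Proof.
move=> sumf x; have [m] := ubnP #|[set y : L | (y <= x)%O]|.
elim: m x => // m IH x; rewrite ltnS => lexm.
have := sumf x; rewrite -sum_moebius (bigD1 x) //= [X in _ = X](bigD1 x) //=.
rewrite [X in f x + X](eq_bigr moebius) => [/addIr //|y /andP[leyx neyx]].
rewrite IH //; apply: leq_trans _ lexm; apply: proper_card; apply/properP; split.
  by apply/subsetP => z; rewrite !inE => /le_trans ->.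
by exists x; rewrite !inE // lt_geF // lt_neqAle neyx.
Qed.

Lemma sum_transversals_by_join (V : nmodType) A (P : pred L)
    (F : {ffun 'I_n -> L} -> V) :
  \sum_(x | P x) \sum_(t in transversals A x) F t =
  \sum_(t | atomic_transversal A t && P (\join_(i < n) t i)%O) F t.
Proof.
rewrite (partition_big (fun t => \join_(i < n) t i)%O P) => [|t /andP[]//].
apply: eq_bigr => x Px; apply: eq_bigl => t; rewrite inE.
by case: eqP => [->|]; rewrite ?Px ?andbT ?andbF.
Qed.

End TransversalExpansion.

Theorem theorem3p3 (d : Order.disp_t) (L : finTBLatticeType d)
  (rho : L -> nat) (n : nat) (A : 'I_n -> {set L})
  (hrho : is_rank_function rho)
  (hA : ordered_atom_partition A)
  (h1 : forall x : L, transversals A x != set0)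
  (h2 : forall (x : L) (t : {ffun 'I_n -> L}),
      t \in transversals A x -> #|supp t| = rho x)
  (h3 : forall x : L, x <> Order.bottom ->
      exists i : 'I_n, #|A i :&: atoms_below x| = 1%N) :
  (forall x : L, moebius x = (-1) ^+ rho x * #|transversals A x|%:R) /\
  char_polynomial rho = \prod_(i < n) ('X - (#|A i|%:R)%:P).
Proof.
have A0 i : \bot%O \notin A i by exact: notin_bot_partition.
have muE x : moebius x = (-1) ^+ rho x * #|transversals A x|%:R.
  apply: (moebius_unique (fun y => (-1) ^+ rho y * #|transversals A y|%:R)).
  move=> {}x.
  transitivity (\prod_(i < n) (1 - #|A i :&: atoms_below x|%:R : int)).
    rewrite transversal_expansion => [|i]; last by rewrite inE (negPf (A0 i)).
    under [RHS]eq_bigl do rewrite atomic_transversal_below //.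
    rewrite -(sum_transversals_by_join _ _ _ (fun y => y <= x)%O).
    apply: eq_bigr => y _.
    rewrite (eq_bigr (fun=> (-1) ^+ rho y)) ?sumr_const ?mulr_natr // => t /h2 ->.
    by rewrite expr1n mulr1.
  (* At [\bot] all truncated blocks are empty and every factor is 1; elsewhere the index from [h3]
     gives a factor [1 - 1]. *)
  have [->|/eqP/h3[i Ai1]] := eqVneq x \bot%O.
    rewrite big1 // => i _; suff -> : A i :&: atoms_below \bot%O = set0.
      by rewrite cards0 subr0.
    apply/setP => a; rewrite !inE lex0.
    by case: (eqVneq a _) => [->|]; rewrite ?(negPf (A0 i)) ?andbF.
  by rewrite (bigD1 i) //= Ai1 subrr mul0r.
split=> //.
have rankL : lattice_rank rho = n.
  apply/eqP; rewrite eqn_leq; apply/andP; split.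
    (* The rank of [x] is the size of a support, hence of a subset of ['I_n]. *)
    apply/bigmax_leqP => x _; have /set0Pn[t /h2 <-] := h1 x.
    by rewrite -[X in (_ <= X)%N]card_ord max_card.
  have exA i : exists a, a \in A i by apply/set0Pn/block_nonempty.
  (* Picking an atom from every block gives full support, so the join of [t] has rank [n]. *)
  pose t := [ffun i => xchoose (exA i)].
  have tA i : t i \in A i by rewrite ffunE; apply: (xchooseP (exA i)).
  apply: leq_trans (leq_bigmax (\join_(i < n) t i)%O).
  rewrite -(h2 _ t); last first.
    by rewrite inE eqxx andbT; apply/forallP => i; rewrite in_setU1 tA orbT.
  rewrite -[X in (X <= _)%N]card_ord -cardsT subset_leq_card //.
  by apply/subsetP => i _; rewrite inE; apply: contraNneq (A0 i) => <-.
under [RHS]eq_bigr do rewrite polyC_natr.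
rewrite transversal_expansion //.
under [RHS]eq_bigl => t do rewrite -[atomic_transversal A t]andbT.
rewrite -(sum_transversals_by_join _ _ _ predT).
apply: eq_bigr => x _; rewrite rankL muE.
(* By [h2] all transversals with join [x] contribute the same monomial, so the inner sum only counts
   them. *)
rewrite [RHS](eq_bigr (fun=> (-1) ^+ rho x * 'X^(n - rho x))).
  rewrite sumr_const -mul_polyC polyCM polyC_natr rmorphXn rmorphN rmorph1 /=.
  by rewrite mulrAC mulr_natr.
by move=> t /h2 ->.
Qed.
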